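(* Let $1\le k\le n$ and let $E_k\in\mathcal{L}(\mathcal{H}_n)$ be any operator with rank $k$. Then $\mathcal{M}_{\{{\rm Ad}_{E_k}\}}=\mathcal{SP}_k$.
   Context: $\mathcal{H}_n$ is an $n$-dimensional complex Hilbert space and $\mathcal{L}(\mathcal{H}_n)$ is the space of linear operators on it. A linear map $\Phi:\mathcal{L}(\mathcal{H}_n)\to\mathcal{L}(\mathcal{H}_n)$ is positive if $\Phi(X)\ge 0$ whenever $X\ge 0$ (positive semidefinite), and completely positive if $id_m\otimes\Phi$ is positive for every $m\in\mathbb{N}$, where $id_m$ is the identity map on $\mathcal{L}(\mathcal{H}_m)$. $\mathcal{P}_1$ and $\mathcal{CP}$ denote the sets of positive and completely positive maps on $\mathcal{L}(\mathcal{H}_n)$. For $A\in\mathcal{L}(\mathcal{H}_n)$, ${\rm Ad}_A(X)=AXA^*$. $\mathcal{SP}_k$ is the set of $k$-superpositive maps: those of the form $\sum_i{\rm Ad}_{A_i}$ (finite sum) with ${\rm rank}(A_i)\le k$ for all $i$. For $\mathcal{Q}\subset\mathcal{P}_1$, the convex mapping cone generated by $\mathcal{Q}$ is $\mathcal{M}_{\mathcal{Q}}:=\{\sum_i\Phi_i\circ\Omega_i\circ\Psi_i:\Omega_i\in\mathcal{Q},\ \Phi_i,\Psi_i\in\mathcal{CP}\ \forall i\}$ (finite sums). *)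

(* Defs.v *)
From HB Require Import structures.
From mathcomp Require Import all_boot all_order all_algebra.
From mathcomp Require Import spectral sesquilinear.
From mathcomp Require Import complex mxtens.
From mathcomp Require Import classical_sets reals.

Set Implicit Arguments.
Unset Strict Implicit.
Unset Printing Implicit Defensive.

Import Order.TTheory GRing.Theory Num.Theory.
Local Open Scope ring_scope.
Local Open Scope sesquilinear_scope.

(* C is R[i] for a realType R in the intended use.  H_n is C^n with its standard inner product, its vectors being columns;
   L(H_n) is 'M[C]_n, adjoints are conjugate transposes, and linear maps
   L(H_n) -> L(H_n) form the type 'End('M[C]_n). *)
Section Maps.
Variable C : numClosedFieldType.

Definition psdmx n (X : 'M[C]_n) : Prop :=
  X \is hermsymmx /\ forall v : 'cV[C]_n, 0 <= (v ^t* *m X *m v) 0 0.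

Definition positive_map n (Phi : 'End('M[C]_n)) : Prop :=
  forall X : 'M[C]_n, psdmx X -> psdmx (Phi X).

(* H_m (x) H_n is C^(m * n), where mxtens_index (i, j) is the index of the
   basis vector e_i (x) e_j, so that an operator on it is an m x m array of
   n x n blocks. *)
Definition tensblock m n (X : 'M[C]_(m * n)) (i j : 'I_m) : 'M[C]_n :=
  \matrix_(a, b) X (mxtens_index (i, a)) (mxtens_index (j, b)).

Definition idtens_fun m n (Phi : 'End('M[C]_n)) (X : 'M[C]_(m * n)) :
    'M[C]_(m * n) :=
  \sum_i \sum_j tensmx (delta_mx i j) (Phi (tensblock X i j)).

Lemma idtens_fun_is_linear m n (Phi : 'End('M[C]_n)) :
  linear (@idtens_fun m n Phi).
Proof.
move=> a X Y; rewrite /idtens_fun scaler_sumr -big_split; apply: eq_bigr => i _.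
rewrite scaler_sumr -big_split; apply: eq_bigr => j _ /=.
have -> : tensblock (a *: X + Y) i j = a *: tensblock X i j + tensblock Y i j.
  by apply/matrixP => k l; rewrite !mxE.
rewrite linearP; apply/matrixP => k l; rewrite !mxE.
by rewrite mulrDr mulrCA.
Qed.

HB.instance Definition _ m n (Phi : 'End('M[C]_n)) :=
  GRing.isLinear.Build C 'M[C]_(m * n) 'M[C]_(m * n) *:%R
    (@idtens_fun m n Phi) (@idtens_fun_is_linear m n Phi).

Definition idtens m n (Phi : 'End('M[C]_n)) : 'End('M[C]_(m * n)) :=
  linfun (@idtens_fun m n Phi).

(* The property that determines id_m (x) Phi among linear maps. *)
Lemma idtensE m n (Phi : 'End('M[C]_n)) (A : 'M[C]_m) (B : 'M[C]_n) :
  idtens m Phi (tensmx A B) = tensmx A (Phi B).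
Proof.
rewrite lfunE /= /idtens_fun.
have E i j : tensblock (tensmx A B) i j = A i j *: B.
  by apply/matrixP => a b; rewrite mxE tensmxE mxE.
under eq_bigr do under eq_bigr do rewrite E linearZ /=.
apply/matrixP => k l; rewrite [RHS]mxE summxE.
rewrite (bigD1 (mxtens_unindex k).1) //= summxE.
rewrite (bigD1 (mxtens_unindex l).1) //= !mxE !eqxx mul1r.
rewrite big1 ?addr0 => [|j /negPf jl]; last first.
  by rewrite !mxE [_ == j]eq_sym jl andbF mul0r.
rewrite big1 ?addr0 // => i /negPf ik; rewrite summxE big1 // => j _.
by rewrite !mxE [_ == i]eq_sym ik mul0r.
Qed.

Definition completely_positive n (Phi : 'End('M[C]_n)) : Prop :=
  forall m : nat, positive_map (idtens m Phi).

Definition Ad n (A : 'M[C]_n) : 'End('M[C]_n) :=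
  linfun (mulmxr (A ^t*) \o mulmx A).

Lemma AdE n (A X : 'M[C]_n) : Ad A X = A *m X *m A ^t*.
Proof. by rewrite lfunE. Qed.

Definition superpositive n (k : nat) : set 'End('M[C]_n) :=
  [set Phi | exists (N : nat) (A : 'I_N -> 'M[C]_n),
     (forall i, (\rank (A i) <= k)%N) /\ Phi = \sum_i Ad (A i)].

Definition mapping_cone n (Q : set 'End('M[C]_n)) : set 'End('M[C]_n) :=
  [set Theta | exists (N : nat) (Phi Omega Psi : 'I_N -> 'End('M[C]_n)),
     (forall i, [/\ completely_positive (Phi i), Q (Omega i)
                  & completely_positive (Psi i)]) /\
     Theta = \sum_i (Phi i \o Omega i \o Psi i)%VF].

(* mapping_cone is meant for sets Q of positive maps, such as [set Ad E]. *)
Lemma Ad_positive n (A : 'M[C]_n) : positive_map (Ad A).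
Proof.
move=> X [/is_hermitianmxP]; rewrite expr0 scale1r => hX pX; rewrite AdE; split.
  apply/is_hermitianmxP; rewrite expr0 scale1r.
  by rewrite !trmx_mul !map_mxM /= trmxCK -hX mulmxA.
move=> v; have := pX (A ^t* *m v).
by rewrite trmx_mul map_mxM /= trmxCK !mulmxA.
Qed.

End Maps.

Arguments superpositive C n k : clear implicits.

(* Main.v *)
(** Kraus decomposition: if [Phi] is completely positive, its Choi matrix, the
    image under [idtens n Phi] of the projection onto [sum_i e_i (x) e_i] (up to
    scaling), is a Gram matrix, and the columns of a Gram factor, reshaped as
    [n x n] matrices, are Kraus operators of [Phi].  So a member of the cone is
    a sum of maps [Ad (A E B)], where [A E B] has rank at most [k]; conversely a
    matrix of rank at most [k = rank E] factors as [B E D]. *)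
Require Import Defs.
From mathcomp Require Import all_boot all_order all_algebra.
From mathcomp Require Import complex classical_sets reals.
From mathcomp Require Import spectral sesquilinear mxtens.

Set Implicit Arguments.
Unset Strict Implicit.
Unset Printing Implicit Defensive.

Import Order.TTheory GRing.Theory Num.Theory.
Local Open Scope ring_scope.
Local Open Scope sesquilinear_scope.
Local Open Scope classical_set_scope.

(** Invertible row and column operations reduce [E] to [pid_mx (\rank E)], and [pid_mx (\rank A)]
    absorbs this larger partial identity, so it can be inserted into the same normal form of [A]. *)
Lemma factor_mxrank (F : fieldType) n (A E : 'M[F]_n) :
  (\rank A <= \rank E)%N -> exists B C, A = B *m E *m C.
Proof.
move=> rAE.
have defE : invmx (col_ebase E) *m E *m invmx (row_ebase E) = pid_mx (\rank E).
  rewrite -{2}[E]mulmx_ebase -!mulmxA mulmxV ?row_ebase_unit // mulmx1.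
  by rewrite mulmxA mulVmx ?col_ebase_unit // mul1mx.
exists (col_ebase A *m pid_mx (\rank A) *m invmx (col_ebase E)).
exists (invmx (row_ebase E) *m row_ebase A).
rewrite -[LHS]mulmx_ebase.
transitivity (col_ebase A *m (pid_mx (\rank A) *m
   (invmx (col_ebase E) *m E *m invmx (row_ebase E))) *m row_ebase A); last first.
  by rewrite !mulmxA.
by rewrite defE mul_pid_mx (minn_idPl rAE) (minn_idPr (rank_leq_row A)).
Qed.

Section Kraus.
Variable C : numClosedFieldType.

Lemma gram_ge0 m (u : 'cV[C]_m) : 0 <= (u ^t* *m u) 0 0.
Proof.
by rewrite mxE sumr_ge0 // => i _; rewrite !mxE mulrC -normCK exprn_ge0.
Qed.

Lemma psdmx_gram m p (W : 'M[C]_(m, p)) : psdmx (W *m W ^t*).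
Proof.
split; first by apply/is_hermitianmxP; rewrite expr0 scale1r trmx_mul map_mxM trmxCK.
move=> v; have := gram_ge0 (W ^t* *m v).
by rewrite trmx_mul map_mxM trmxCK !mulmxA.
Qed.

(** Spectral theorem: diagonalize [X] in a unitary basis and take square roots of its
    eigenvalues. *)
Lemma psdmx_gramE m (X : 'M[C]_m) :
  psdmx X -> exists W : 'M[C]_m, X = W *m W ^t*.
Proof.
move=> [hX pX]; set P := spectralmx X; set d := spectral_diag X.
have uP : P \is unitarymx := spectral_unitarymx X.
have defX : X = P ^t* *m diag_mx d *m P.
  by rewrite -(invmx_unitary uP); apply/orthomx_spectralP/hermitian_normalmx.
have d_ge0 i : 0 <= d 0 i.
  (* This vector is the [i]-th eigenvector, at which the quadratic form takes the value [d 0 i]. *)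
  have := pX (P ^t* *m delta_mx i 0).
  rewrite trmx_mul map_mxM trmxCK {1}defX !mulmxA.
  rewrite -[_ *m P *m P ^t*]mulmxA (unitarymxP uP) mulmx1.
  rewrite -[_ *m P *m P ^t*]mulmxA (unitarymxP uP) mulmx1.
  rewrite trmx_delta map_delta_mx -rowE -colE !mxE.
  by rewrite eqxx mulr1n.
pose D := diag_mx (\row_i sqrtC (d 0 i)).
exists (P ^t* *m D).
rewrite trmx_mul map_mxM trmxCK mulmxA -[P ^t* *m D *m _]mulmxA {1}defX.
congr (_ *m _ *m _); rewrite tr_diag_mx map_diag_mx mulmx_diag.
congr diag_mx; apply/rowP => i; rewrite !mxE /=.
by rewrite conj_Creal ?ger0_real ?sqrtC_ge0 // -expr2 sqrtCK.
Qed.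

Lemma tensblock_idtens m n (Phi : 'End('M[C]_n)) (X : 'M[C]_(m * n)) i j :
  tensblock (idtens m Phi X) i j = Phi (tensblock X i j).
Proof.
rewrite lfunE /= /idtens_fun; apply/matrixP => a b; rewrite mxE summxE.
rewrite (bigD1 i) //= summxE (bigD1 j) //= tensmxE mxE !eqxx mul1r.
rewrite big1 ?addr0 => [|l /negPf jl]; last first.
  by rewrite tensmxE mxE [j == l]eq_sym jl andbF mul0r.
rewrite big1 ?addr0 // => l /negPf il; rewrite summxE big1 // => ? _.
by rewrite tensmxE mxE [i == l]eq_sym il mul0r.
Qed.

Lemma tensblockP m n (X Y : 'M[C]_(m * n)) :
  (forall i j, tensblock X i j = tensblock Y i j) -> X = Y.
Proof.
move=> XY; apply/matrixP => k l.
case: (mxtens_indexP k) => i a; case: (mxtens_indexP l) => j b.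
by have /matrixP/(_ a b) := XY i j; rewrite !mxE.
Qed.

(** The right-hand side is [idtens_fun] of the identity map, which fixes every block. The expansion
    reduces equalities of linear maps to simple tensors. *)
Lemma tensmx_delta_sum m n (X : 'M[C]_(m * n)) :
  X = \sum_i \sum_j tensmx (delta_mx i j) (tensblock X i j).
Proof.
apply: tensblockP => i j; have := @tensblock_idtens m n \1%VF X i j.
by rewrite lfunE /= /idtens_fun id_lfunE => <-; congr tensblock;
  do 2!apply: eq_bigr => ? _; rewrite id_lfunE.
Qed.

Lemma idtens_Ad m n (A : 'M[C]_n) : idtens m (Ad A) = Ad (tensmx 1%:M A).
Proof.
apply/lfunP => X; rewrite [X]tensmx_delta_sum !linear_sum /=.
apply: eq_bigr => i _; rewrite !linear_sum; apply: eq_bigr => j _ /=.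
rewrite idtensE !AdE trmx_tens map_mxT trmx1 map_mx1 !tensmx_mul.
by rewrite mul1mx mulmx1.
Qed.

Lemma Ad_completely_positive n (A : 'M[C]_n) : completely_positive (Ad A).
Proof. by move=> m; rewrite idtens_Ad; apply: Ad_positive. Qed.

Lemma lfun_deltaP n (Phi Psi : 'End('M[C]_n)) :
  (forall i j, Phi (delta_mx i j) = Psi (delta_mx i j)) -> Phi = Psi.
Proof.
move=> PP; apply/lfunP => X; rewrite [X]matrix_sum_delta !linear_sum.
apply: eq_bigr => i _; rewrite !linear_sum; apply: eq_bigr => j _.
by rewrite !linearZ /= PP.
Qed.

Lemma completely_positive_kraus n (Phi : 'End('M[C]_n)) :
  completely_positive Phi ->
  exists (N : nat) (A : 'I_N -> 'M[C]_n), Phi = \sum_i Ad (A i).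
Proof.
move=> cpPhi.
(* The vector [sum_i e_i (x) e_i]. The blocks of its rank-one matrix are the matrix units, so block
   [(i, j)] of the Choi matrix is [Phi (delta_mx i j)]. *)
pose om : 'cV[C]_(n * n) :=
  \col_k ((mxtens_unindex k).1 == (mxtens_unindex k).2)%:R.
have om_block i j : tensblock (om *m om ^t*) i j = delta_mx i j.
  apply/matrixP => a b; rewrite !mxE big_ord1 !mxE !mxtens_indexK /=.
  by rewrite conjC_nat -natrM mulnb [i == a]eq_sym [j == b]eq_sym.
have [W defW] := psdmx_gramE (cpPhi n _ (psdmx_gram om)).
(* The first tensor index becomes the column index: column [i] of the [l]-th Kraus operator is the
   [i]-th segment of column [l] of [W]. *)
exists (n * n)%N, (fun l => \matrix_(a, i) W (mxtens_index (i, a)) l).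
apply: lfun_deltaP => i j; rewrite -om_block -tensblock_idtens defW om_block.
apply/matrixP => a b; rewrite sum_lfunE summxE !mxE.
(* Splitting the matrix unit as [e_i e_j^*] leaves column [i] of the Kraus operator times the
   adjoint of its column [j]. *)
apply: eq_bigr => l _; rewrite AdE -(mul_delta_mx (0 : 'I_1)).
by rewrite mulmxA -colE -mulmxA -rowE !mxE big_ord1 !mxE.
Qed.

Lemma Ad_comp n (A B : 'M[C]_n) : (Ad A \o Ad B)%VF = Ad (A *m B).
Proof.
by apply/lfunP => X; rewrite comp_lfunE !AdE trmx_mul map_mxM !mulmxA.
Qed.

Lemma superpositive_Ad n k (A : 'M[C]_n) :
  (\rank A <= k)%N -> superpositive C n k (Ad A).
Proof. by move=> rA; exists 1%N, (fun=> A); rewrite big_ord1. Qed.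

Lemma superpositive_sum n k (I : finType) (F : I -> 'End('M[C]_n)) :
  (forall i, superpositive C n k (F i)) -> superpositive C n k (\sum_i F i).
Proof.
move=> spF; apply: big_ind => //.
  by exists 0%N, (fun=> 0); split=> [[]//|]; rewrite big_ord0.
move=> _ _ [N [A [rA ->]]] [M [B [rB ->]]].
exists (N + M)%N.
exists (fun i => match split i with inl j => A j | inr j => B j end).
split=> [i|]; first by case: (split i).
rewrite big_split_ord /=; congr (_ + _); apply: eq_bigr => i _.
  by rewrite (unsplitK (inl i)).
by rewrite (unsplitK (inr i)).
Qed.

Lemma mapping_cone_Ad n (E : 'M[C]_n) :
  mapping_cone [set Ad E] = superpositive C n (\rank E).
Proof.
apply/seteqP; split=> [_ [N [Phi [Omega [Psi [cp ->]]]]]|_ [N [A [rA ->]]]].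
  apply: superpositive_sum => i; have [cpPhi -> cpPsi] := cp i.
  have [p [A ->]] := completely_positive_kraus cpPhi.
  have [q [B ->]] := completely_positive_kraus cpPsi.
  (* Composition is bilinear, and [Ad] is multiplicative. *)
  have -> : (((\sum_a Ad (A a)) \o Ad E) \o \sum_b Ad (B b))%VF
          = \sum_a \sum_b Ad (A a *m E *m B b).
    apply/lfunP => X; rewrite !comp_lfunE !sum_lfunE; apply: eq_bigr => a _.
    rewrite !linear_sum sum_lfunE; apply: eq_bigr => b _.
    by rewrite -!Ad_comp !comp_lfunE.
  do 2!apply: superpositive_sum => ?; apply: superpositive_Ad.
  exact: leq_trans (mxrankM_maxl _ _) (mxrankM_maxr _ _).
(* Conversely, each [A i] factors as [B i *m E *m D i], so the outer maps [Ad (B i)] and [Ad (D i)]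
   exhibit the sum as a member of the cone. *)
have /boolp.choice [B /boolp.choice [D defA]] := fun i => factor_mxrank (rA i).
exists N, (fun i => Ad (B i)), (fun=> Ad E), (fun i => Ad (D i)); split=> [i|].
  by split=> //; apply: Ad_completely_positive.
by apply: eq_bigr => i _; rewrite !Ad_comp -defA.
Qed.

End Kraus.

Theorem proposition5 (R : realType) (n k : nat) (hk1 : (1 <= k)%N)
    (hkn : (k <= n)%N) (E : 'M[R[i]]_n) (hE : \rank E = k) :
  mapping_cone [set Ad E] = superpositive R[i] n k.
Proof. by rewrite -hE mapping_cone_Ad. Qed.
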